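(* Let $n\ge 1$ be an integer, let $0<\lambda<1$, and suppose $\alpha$ and $p$ satisfy $$\Bigl(p>1\text{ and }0<\alpha<\tfrac{n+2}{2p}\Bigr)\quad\text{or}\quad\Bigl(p=1\text{ and }0<\alpha\le\tfrac{n+2}{2}\Bigr).$$ Then the only nonnegative solution $u\in Y^p_\alpha$ of the problem $$(\partial_t-\Delta)^\alpha u\ge u^\lambda\ \text{ in }\mathbb{R}^n\times\mathbb{R},\qquad u=0\ \text{ in }\mathbb{R}^n\times(-\infty,0)$$ is the trivial solution $u\equiv0$.
   Context: For $\alpha>0$ the fractional heat kernel is $$\Phi_\alpha(x,t)=\frac{t^{\alpha-1}}{\Gamma(\alpha)}\frac{1}{(4\pi t)^{n/2}}e^{-|x|^2/(4t)}\ \text{ for } t>0,\qquad \Phi_\alpha(x,t)=0\ \text{ for } t\le 0,\qquad x\in\mathbb{R}^n.$$ $X^p$ is the set of all measurable $f:\mathbb{R}^n\times\mathbb{R}\to\mathbb{R}$ with $\|f\|_{L^p(\mathbb{R}^n\times(-\infty,T))}<\infty$ for all $T\in\mathbb{R}$. Define $$J_\alpha f(x,t)=\iint_{\mathbb{R}^n\times(-\infty,t)}\Phi_\alpha(x-\xi,t-\tau)f(\xi,\tau)\,d\xi\,d\tau,\qquad Y^p_\alpha:=J_\alpha(X^p).$$ When $(p>1$ and $0<\alpha<\frac{n+2}{2p})$ or $(p=1$ and $0<\alpha\le\frac{n+2}{2})$, it is known that $J_\alpha f\in L^p_{\rm loc}(\mathbb{R}^n\times\mathbb{R})$ for $f\in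 X^p$, that $J_\alpha:X^p\to Y^p_\alpha$ is one-to-one and onto, and that if $f\in X^p$ and $u=J_\alpha f$ then $f=0$ in $\mathbb{R}^n\times(-\infty,0)$ if and only if $u=0$ in $\mathbb{R}^n\times(-\infty,0)$. The operator $(\partial_t-\Delta)^\alpha:Y^p_\alpha\to X^p$ is defined as the inverse of $J_\alpha:X^p\to Y^p_\alpha$. Functions equal almost everywhere are identified and (in)equalities are understood almost everywhere. *)

(* Defs.v *)
From HB Require Import structures.
From mathcomp Require Import all_boot all_order all_algebra.
From mathcomp Require Import all_classical all_reals all_analysis.

Set Implicit Arguments.
Unset Strict Implicit.
Unset Printing Implicit Defensive.
Import Order.TTheory GRing.Theory Num.Theory.
Import numFieldNormedType.Exports.

Local Open Scope classical_set_scope.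
Local Open Scope ring_scope.

(* The Borel sigma-algebra is the library's one on tuples, generated by the
   coordinates. *)
Notation Rn R n := (n.-tuple (measurableTypeR R)).
Notation spacetime R n := (Rn R n * measurableTypeR R)%type.

Lemma product_measure_sigma_finite d1 d2 (T1 : measurableType d1)
    (T2 : measurableType d2) (R : realType)
    (m1 : {sigma_finite_measure set T1 -> \bar R})
    (m2 : {sigma_finite_measure set T2 -> \bar R}) :
  sigma_finite setT (m1 \x m2)%E.
Proof.
have /sigma_finiteP[F [TF ndF Foo]] := sigma_finiteT m1.
have /sigma_finiteP[G [TG ndG Goo]] := sigma_finiteT m2.
exists (fun n => F n `*` G n).
  rewrite -setXTT TF TG predeqE => -[x y]; split.
    move=> [/= [n _ Fnx] [k _ Gky]]; exists (maxn n k) => //; split.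
    - by move: x Fnx; exact/subsetPset/ndF/leq_maxl.
    - by move: y Gky; exact/subsetPset/ndG/leq_maxr.
  by move=> [n _ []/= ? ?]; split; exists n.
move=> k; have [? ?] := Foo k; have [? ?] := Goo k.
split; first exact: measurableX.
by rewrite product_measure1E// lte_mul_pinfty// ge0_fin_numE.
Qed.

Section lebesgue_Rn.
Context {R : realType}.

Definition cons_pair {n} (z : measurableTypeR R * Rn R n) : Rn R n.+1 :=
  [tuple of z.1 :: z.2].

Definition uncons_pair {n} (x : Rn R n.+1) : measurableTypeR R * Rn R n :=
  (tnth x ord0, [tuple of behead x]).

Lemma cons_pairK n : cancel (@cons_pair n) uncons_pair.
Proof.
by move=> [x y]; congr pair; apply/val_inj.
Qed.

Lemma measurable_cons_pair n : measurable_fun setT (@cons_pair n).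
Proof. exact: measurable_cons. Qed.

Lemma measurable_uncons_pair n : measurable_fun setT (@uncons_pair n).
Proof.
apply/measurable_fun_pair => /=; first exact: measurable_tnth.
exact: measurable_behead.
Qed.

Section cons_measure.
Context {n : nat} (m : {sigma_finite_measure set (Rn R n) -> \bar R}).
Local Open Scope ereal_scope.

Definition cons_measure : set (Rn R n.+1) -> \bar R :=
  pushforward (@lebesgue_measure R \x m) cons_pair.

HB.instance Definition _ := Measure.copy cons_measure
  (measure_function_pushforward__canonical__measure_function_Measure
     (@lebesgue_measure R \x m) (@measurable_cons_pair n)).

Let cons_measure_sigma_finite : sigma_finite setT cons_measure.
Proof.
have [F TF Foo] := product_measure_sigma_finite (@lebesgue_measure R) m.
exists (fun k => uncons_pair @^-1` F k).
  by rewrite -preimage_bigcup -TF preimage_setT.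
move=> k; have [mF Fk] := Foo k; split.
  by rewrite -[X in measurable X]setTI; exact: measurable_uncons_pair.
rewrite /cons_measure /pushforward -comp_preimage.
by rewrite (_ : _ \o _ = id) //; apply/funext => z /=; rewrite cons_pairK.
Qed.

HB.instance Definition _ := Measure_isSigmaFinite.Build _ _ _ cons_measure
  cons_measure_sigma_finite.

End cons_measure.

Fixpoint lebesgue_Rn n : {sigma_finite_measure set (Rn R n) -> \bar R} :=
  match n with
  | 0 => \d_([tuple] : Rn R 0)
  | k.+1 => cons_measure (lebesgue_Rn k)
  end.

Definition lebesgue_spacetime n : set (spacetime R n) -> \bar R :=
  (lebesgue_Rn n \x @lebesgue_measure R)%E.
Arguments lebesgue_spacetime : clear implicits.

HB.instance Definition _ n := Measure.on (lebesgue_spacetime n).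
HB.instance Definition _ n := Measure_isSigmaFinite.Build _ _ _
  (lebesgue_spacetime n)
  (product_measure_sigma_finite (lebesgue_Rn n) (@lebesgue_measure R)).

End lebesgue_Rn.
Arguments lebesgue_spacetime {R} n.

Section fractional_heat.
Context {R : realType}.
Implicit Types (alpha p : R).

Definition Gamma (a : R) : R :=
  \int[@lebesgue_measure R]_(s in `]0, +oo[) (s `^ (a - 1) * expR (- s)).

Definition sqr_norm {n} (x : Rn R n) : R := \sum_(i < n) tnth x i ^+ 2.

Definition sub_Rn {n} (x y : Rn R n) : Rn R n :=
  [tuple tnth x i - tnth y i | i < n].

Definition Phi {n} alpha (x : Rn R n) (t : R) : R :=
  if 0 < t then
    t `^ (alpha - 1) / Gamma alpha * (1 / (4 * pi * t) `^ (n%:R / 2))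
      * expR (- sqr_norm x / (4 * t))
  else 0.

Local Notation mu n := (@lebesgue_spacetime R n).

Definition before {n} (T : R) : set (spacetime R n) := [set z | z.2 < T].

(* Elements are Borel functions, hence representatives of the classes, modulo
   equality almost everywhere, of Lebesgue measurable functions. *)
Definition X {n} p : set (spacetime R n -> R) :=
  [set f | measurable_fun setT f /\
           forall T : R, finite_norm (mu n) p%:E (f \_ (before T))].

(* The value is an extended real: \int is the difference of the integrals of
   the positive and negative parts, and it is a real number exactly when the
   integral converges absolutely. *)
Definition J {n} alpha (f : spacetime R n -> R) (z : spacetime R n) : \bar R :=
  (\int[mu n]_(w in before z.2)
     (Phi alpha (sub_Rn z.1 w.1) (z.2 - w.2) * f w)%:E)%E.

(* [frac_heat alpha p u] is the set of representatives f in X^p of the class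
   (d_t - Delta)^alpha u, i.e. of the preimages of u under J_alpha; u itself
   only matters up to equality almost everywhere. *)
Definition frac_heat {n} alpha p (u : spacetime R n -> R) :
    set (spacetime R n -> R) :=
  [set f | X p f /\ {ae mu n, forall z, (u z)%:E = J alpha f z}].

(* Y^p_alpha = J_alpha(X^p) *)
Definition Y {n} alpha p : set (spacetime R n -> R) :=
  [set u | exists2 f, X p f & {ae mu n, forall z, (u z)%:E = J alpha f z}].

End fractional_heat.

(* Main.v *)
Require Import Defs.
From mathcomp Require Import all_boot all_order all_algebra.
From mathcomp Require Import all_classical all_reals all_analysis.
From mathcomp Require Import measurable_realfun ring lra.

Set Implicit Arguments.
Unset Strict Implicit.
Unset Printing Implicit Defensive.
Import Order.TTheory GRing.Theory Num.Theory.
Import numFieldNormedType.Exports.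

Local Open Scope classical_set_scope.
Local Open Scope ring_scope.

(** A supersolution [f >= (J f)^lambda] that is nonnegative and not almost
everywhere zero cannot lie in [X p], because it stays bounded away from zero on
a whole slab [R^n x (t0 + 1/2, t0 + 3/4)].  Positivity of the heat kernel gives,
after some time [t0] and on every cube [|x_i| <= N], a bound
[f >= c (t - t0)^b] with some [c > 0] depending on [N], where
[b = lambda (alpha + b)].  Integrating the kernel only over a box of side
comparable to [sqrt (t - t0)], contained in the cube and touching [x], shows
that [c] may be replaced with [(kappa c)^lambda], where [kappa] does not depend
on [N].  As [lambda < 1], iterating drives the constant to the fixed point
[kappa^(lambda / (1 - lambda))], so that the bound is uniform in [N]. *)

(** * Pointwise lower bounds for the kernel *)

Lemma sqr_norm_le (R : realType) n (x : Rn R n) (l : R) :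
  (forall i, `|tnth x i| <= l) -> sqr_norm x <= n%:R * l ^+ 2.
Proof.
move=> xl; rewrite /sqr_norm -[n in n%:R]card_ord mulr_natl -sumr_const.
apply: ler_sum => i _; rewrite -real_normK ?num_real// ler_sqr ?nnegrE//.
by rewrite (le_trans _ (xl i)).
Qed.

Lemma Phi_ge0 (R : realType) n alpha (x : Rn R n) t : 0 <= Gamma alpha ->
  0 <= Phi alpha x t.
Proof.
move=> G0; rewrite /Phi; case: ifPn => // t0.
by rewrite !mulr_ge0 ?powR_ge0 ?expR_ge0 ?invr_ge0 ?powR_ge0.
Qed.

Lemma Gamma_ge0 (R : realType) (a : R) : 0 <= Gamma a.
Proof.
by apply: Rintegral_ge0 => s _; rewrite mulr_ge0 ?powR_ge0 ?expR_ge0.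
Qed.

(** Each factor is estimated at its worst time. Since [alpha - 1] may have either sign,
    [t^(alpha - 1)] is split as [t^alpha / t]: the numerator is taken at [s1], the denominator at
    [s2]. The Gaussian normalisation is smallest at [s2], the exponential at [s1]. *)
Lemma Phi_ge (R : realType) n alpha (x : Rn R n) (s1 s2 t l : R) :
  0 <= alpha -> 0 < s1 -> s1 <= t -> t <= s2 -> 0 <= Gamma alpha ->
  (forall i, `|tnth x i| <= l) ->
  s1 `^ alpha / s2 / Gamma alpha * (1 / (4 * pi * s2) `^ (n%:R / 2))
    * expR (- (n%:R * l ^+ 2) / (4 * s1)) <= Phi alpha x t.
Proof.
move=> a0 s10 s1t ts2 G0 xl.
have t0 : 0 < t := lt_le_trans s10 s1t.
have s20 : 0 < s2 := lt_le_trans t0 ts2.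
rewrite /Phi t0.
have ->: t `^ (alpha - 1) = t `^ alpha / t.
  by rewrite powRB ?powRr1 ?ltW// (gt_eqF t0) implybT.
have pi0 := pi_gt0 R.
apply: ler_pM.
- by rewrite !mulr_ge0 ?powR_ge0 ?invr_ge0 ?powR_ge0// ltW.
- exact: expR_ge0.
- apply: ler_pM.
  + by rewrite !mulr_ge0 ?powR_ge0 ?invr_ge0// ltW.
  + by rewrite !mul1r invr_ge0 powR_ge0.
  + apply: ler_wpM2r; first by rewrite invr_ge0.
    apply: ler_pM; rewrite ?powR_ge0 ?invr_ge0 ?(ltW s20)// ?lef_pV2//.
    by rewrite ge0_ler_powR// nnegrE ltW.
  + rewrite !mul1r lef_pV2 ?posrE ?powR_gt0 ?mulr_gt0//.
    have p40 : 0 < 4 * pi :> R by rewrite mulr_gt0.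
    rewrite ge0_ler_powR ?divr_ge0// ?ler_pM2l// ?nnegrE; apply/ltW/mulr_gt0 => //.
- rewrite ler_expR !mulNr lerN2; apply: ler_pM.
  + by rewrite /sqr_norm sumr_ge0// => i _; rewrite sqr_ge0.
  + by rewrite invr_ge0 mulr_ge0// ltW.
  + exact: sqr_norm_le.
  + by rewrite lef_pV2 ?posrE ?mulr_gt0// ler_pM2l.
Qed.

(** * Boxes and measurability *)

Lemma measurable_box (R : realType) n (a b : 'I_n -> R) :
  measurable [set y : Rn R n | forall i, a i <= tnth y i <= b i].
Proof.
have -> : [set y : Rn R n | forall i, a i <= tnth y i <= b i] =
    \bigcap_(i in [set: 'I_n])
      ((fun y : Rn R n => tnth y i : R) @^-1` (`[a i, b i] : set R)).
  apply/seteqP; split=> y /= h i; have := h i; rewrite ?in_itv/= //.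
  by move/(_ I); rewrite in_itv.
apply: fin_bigcap_measurable => // i _; rewrite -[X in measurable X]setTI.
exact: measurable_tnth.
Qed.

(** Induction on the dimension: the preimage of a cube under [cons_pair] is an interval times a cube
    of one dimension less. *)
Lemma lebesgue_Rn_cube (R : realType) n (a : 'I_n -> R) (l : R) : 0 <= l ->
  lebesgue_Rn n [set y : Rn R n | forall i, a i <= tnth y i <= a i + l] = (l ^+ n)%:E.
Proof.
move=> l0; elim: n a => [|n ih] a.
  by rewrite /= diracE expr0 mem_set// => -[].
rewrite /= /cons_measure /pushforward.
set B := [set y : Rn R n | forall i, a (lift ord0 i) <= tnth y i <= a (lift ord0 i) + l].
have -> : cons_pair @^-1` [set y : Rn R n.+1 | forall i, a i <= tnth y i <= a i + l]
    = `[a ord0, a ord0 + l] `*` B.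
  apply/seteqP; split => -[x y] /=.
    move=> h; split; first by rewrite in_itv/=; exact: (h ord0).
    by move=> i; have := h (lift ord0 i); rewrite /cons_pair/= tnthS.
  move=> [+ h] i; rewrite in_itv/= => xa; case: (unliftP ord0 i) => [j|] ->.
    by rewrite tnthS; exact: h.
  by rewrite tnth0.
rewrite product_measure1E//; last exact: measurable_box.
rewrite ih/= lebesgue_measure_itv/= lte_fin ltrDl.
rewrite exprS; case: ltP => [_|l1]; first by rewrite -EFinD -EFinM addrAC subrr add0r.
by have -> : l = 0 by apply/eqP; rewrite eq_le l1 l0; rewrite ?mul0e ?mul0r.
Qed.

Lemma measurable_Phi (R : realType) n alpha (x : Rn R n) (t : R) :
  measurable_fun setT (fun w : spacetime R n => Phi alpha (sub_Rn x w.1) (t - w.2)).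
Proof.
(* Divisions by time-dependent terms become negative powers, to which measurability of [powR]
   applies; both forms agree for positive times. *)
pose g (w : spacetime R n) (y : R) :=
  y `^ (alpha - 1) / Gamma alpha * (4 * pi * y) `^ (- (n%:R / 2))
    * expR (- sqr_norm (sub_Rn x w.1) * (4 * y) `^ (-1)).
rewrite (_ : (fun w => _) = fun w => if 0 < t - w.2 then g w (t - w.2) else 0).
  have mt : measurable_fun setT (fun w : spacetime R n => t - w.2).
    exact: measurable_funB.
  apply: measurable_fun_ifT => //; first exact: measurable_fun_ltr.
  apply: measurable_funM.
    apply: measurable_funM.
      apply: measurable_funM => //.
      exact: (measurableT_comp (measurable_powR _) mt).
    apply: (measurableT_comp (measurable_powR _)).
    exact: measurable_funM.
  apply: measurableT_comp => //; apply: measurable_funM.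
    apply: measurableT_comp => //; apply: measurable_sum => i.
    apply: measurable_funX.
    under eq_fun do rewrite tnth_mktuple.
    apply: measurable_funB => //.
    exact: (measurableT_comp (measurable_tnth i) measurable_fst).
  apply: (measurableT_comp (measurable_powR _)).
  exact: measurable_funM.
apply/funext => w; rewrite /Phi; case: ifPn => // t0.
by rewrite /g powRN powR_inv1 ?mulr_ge0 ?(ltW t0)// mul1r.
Qed.

Lemma measurable_before (R : realType) n (T : R) :
  measurable (before T : set (spacetime R n)).
Proof.
have -> : before T = setT `&` (fun w : spacetime R n => w.2 < T) @^-1` [set true].
  by rewrite setTI; apply/seteqP; split.
exact: measurable_fun_ltr.
Qed.

Lemma measurable_Phi_mul (R : realType) n alpha (f : spacetime R n -> R)
    (x : Rn R n) (t : R) (D : set (spacetime R n)) :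
  measurable_fun setT f ->
  measurable_fun D
    (fun w : spacetime R n => (Phi alpha (sub_Rn x w.1) (t - w.2) * f w)%:E).
Proof.
move=> mf; apply: measurable_funTS; apply/measurable_EFinP.
by apply: measurable_funM => //; exact: measurable_Phi.
Qed.

(** * Elementary properties of the potential [J] *)

Lemma J_ae_eq (R : realType) n alpha (f g : spacetime R n -> R) :
  measurable_fun setT f -> measurable_fun setT g ->
  {ae lebesgue_spacetime n, forall z, f z = g z} -> J alpha f = J alpha g.
Proof.
move=> mf mg fg; apply/funext => z; apply: ae_eq_integral.
- exact: measurable_before.
- exact: measurable_Phi_mul.
- exact: measurable_Phi_mul.
- by apply: filterS fg => w -> _.
Qed.

Lemma J0 (R : realType) n alpha (z : spacetime R n) : J alpha (cst 0) z = 0%E.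
Proof. by rewrite /J; under eq_integral do rewrite mulr0; exact: integral0. Qed.

(** The integrand is nonnegative, so shrinking the domain to [A] only lowers the integral. Both the
    starting bound and the improvement step come from this estimate. *)
Lemma J_ge (R : realType) n alpha (f : spacetime R n -> R) (A : set (spacetime R n))
    (z : spacetime R n) (k : R) :
  measurable_fun setT f -> (forall w, 0 <= f w) ->
  measurable A -> A `<=` before z.2 -> 0 <= k ->
  {ae lebesgue_spacetime n, forall w, A w ->
     k <= Phi alpha (sub_Rn z.1 w.1) (z.2 - w.2) * f w} ->
  (k%:E * lebesgue_spacetime n A <= J alpha f z)%E.
Proof.
move=> mf f0 mA Az k0 kf.
have Pf0 w : 0 <= Phi alpha (sub_Rn z.1 w.1) (z.2 - w.2) * f w.
  by rewrite mulr_ge0// Phi_ge0// Gamma_ge0.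
rewrite -integral_cst//; apply: (@le_trans _ _ (\int[lebesgue_spacetime n]_(w in A)
     (Phi alpha (sub_Rn z.1 w.1) (z.2 - w.2) * f w)%:E)%E).
  apply: ae_ge0_le_integral => //.
  - by move=> w _; rewrite lee_fin.
  - exact: measurable_Phi_mul.
apply: ge0_subset_integral => //.
- exact: measurable_before.
- exact: measurable_Phi_mul.
- by move=> w _; rewrite lee_fin.
Qed.

(** * The scalar recursion, and volumes of space-time cylinders *)

(** In logarithmic scale the map is a contraction of ratio [lambda] about its fixed point [cs]: from
    [c0 = cs * q], the iterate of rank [k] is [cs * q^(lambda^k)]. Stopping at [cs / 2] takes
    finitely many steps, so [P] is never passed to a limit. *)
Lemma sublinear_iteration (R : realType) (P : R -> Prop) (lambda kappa c0 : R) :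
  0 < lambda < 1 -> 0 < kappa -> 0 < c0 -> P c0 ->
  (forall c, 0 < c -> P c -> P ((kappa * c) `^ lambda)) ->
  (forall c d, d <= c -> P c -> P d) ->
  P (kappa `^ (lambda / (1 - lambda)) / 2).
Proof.
move=> /andP[l0 l1] k0 c00 Pc0 Pstep Pdown.
set cs := kappa `^ _.
have cs0 : 0 < cs by rewrite powR_gt0.
have csE : (kappa * cs) `^ lambda = cs.
  rewrite powRM ?ltW// -powRrM -powRD; last by rewrite (gt_eqF k0) implybT.
  by congr (_ `^ _); field; lra.
pose q := c0 / cs.
have q0 : 0 < q by rewrite divr_gt0.
have Pk k : P (cs * q `^ (lambda ^+ k)).
  elim: k => [|k ih].
    by rewrite expr0 powRr1 ?ltW// /q mulrC divfK ?gt_eqF.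
  have := Pstep _ (mulr_gt0 cs0 (powR_gt0 _ q0)) ih.
  rewrite mulrA [X in P X]powRM ?powR_ge0 ?mulr_ge0 ?(ltW k0) ?(ltW cs0)//.
  by rewrite csE -powRrM exprSr.
(* Then [q^(lambda^k) = exp (lambda^k * ln q) >= 1 + lambda^k * ln q >= 1/2]. *)
have [k kq] : exists k, lambda ^+ k * `|ln q| <= 2^-1.
  have /cvgr0Pnorm_lt/(_ (2^-1 / (`|ln q| + 1))) : lambda ^+ k @[k --> \oo] --> 0.
    by apply: cvg_expr; rewrite gtr0_norm.
  rewrite divr_gt0 ?invr_gt0 ?ltr_wpDl// => /(_ isT)[k _ /(_ k (leqnn k))/=].
  rewrite ger0_norm ?exprn_ge0 ?ltW// ltr_pdivlMr ?ltr_wpDl// => h.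
  by exists k; apply/ltW/(le_lt_trans _ h); rewrite ler_wpM2l ?exprn_ge0 ?ltW// ltrDl.
apply: Pdown (Pk k); rewrite ler_pM2l// /powR (gt_eqF q0).
apply: le_trans (expR_ge1Dx _).
have : - `|ln q| <= ln q by rewrite lerNl ler_normr lexx orbT.
move/(ler_wpM2l (exprn_ge0 k (ltW l0))); lra.
Qed.

Lemma lebesgue_spacetime_cylinder (R : realType) n (a : 'I_n -> R) (l t h : R) :
  0 <= l -> 0 <= h ->
  lebesgue_spacetime n ([set y : Rn R n | forall i, a i <= tnth y i <= a i + l]
    `*` `[t, t + h]) = (l ^+ n * h)%:E.
Proof.
move=> l0 h0; rewrite /lebesgue_spacetime product_measure1E//; last exact: measurable_box.
rewrite [X in (X * _)%E](lebesgue_Rn_cube a l0).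
rewrite /= lebesgue_measure_itv/= lte_fin ltrDl.
case: ltP => [_|h1]; first by rewrite -EFinD -EFinM; congr (_ * _)%:E; ring.
by have -> : h = 0 by apply/eqP; rewrite eq_le h1 h0; rewrite ?mule0 ?mulr0.
Qed.

(** * Improving a lower bound *)

(** [J] is extended real; [v] records its finiteness before the real power is taken. *)
Definition supersolution (R : realType) n (lambda alpha : R)
    (f : spacetime R n -> R) :=
  {ae lebesgue_spacetime n, forall z,
    exists2 v : R, J alpha f z = v%:E & v `^ lambda <= f z}.

(** The time window has length 1, so that [(t - t0)^b <= 1] at the start and the boxes of the
    improvement step have side at most [(4 pi)^(1/2)]. *)
Definition bounded_below (R : realType) n (f : spacetime R n -> R) (t0 b N c : R) :=
  {ae lebesgue_spacetime n, forall z, (forall i, `|tnth z.1 i| <= N) ->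
    t0 < z.2 < t0 + 1 -> c * (z.2 - t0) `^ b <= f z}.

(* The constant kappa of the header, from integrating the kernel over [l ^ n] times
   [s / 2], where [s = (t - t0) / 2] and [l = sqrt (4 pi s)]. *)
Definition gain (R : realType) (n : nat) (alpha b : R) : R :=
  expR (- (2 * pi * n%:R)) / (2 * Gamma alpha) * (2^-1 `^ b * 4^-1 `^ alpha).

(** Parabolic scaling: with distances up to [(4 pi s)^(1/2)] and times comparable to [s], the
    Gaussian exponent is bounded independently of [s]. *)
Lemma Phi_near_ge (R : realType) n (alpha : R) (x : Rn R n) (s t : R) :
  0 <= alpha -> 0 < s ->
  s / 2 <= t <= s -> 0 <= Gamma alpha ->
  (forall i, `|tnth x i| <= (4 * pi * s) `^ 2^-1) ->
  (s / 2) `^ alpha / s / Gamma alpha * (1 / (4 * pi * s) `^ (n%:R / 2))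
    * expR (- (2 * pi * n%:R)) <= Phi alpha x t.
Proof.
move=> a0 s0 /andP[st ts] G0 xl.
have := Phi_ge a0 _ st ts G0 xl; rewrite divr_gt0// => /(_ isT).
rewrite -powR_mulrn ?powR_ge0// -powRrM mulVf// powRr1 ?mulr_ge0 ?pi_ge0 ?(ltW s0)//.
suff -> : - (n%:R * (4 * pi * s)) / (4 * (s / 2)) = - (2 * pi * n%:R) :> R by [].
by field; rewrite gt_eqF.
Qed.

(** Integrating [f >= c s^b] over a nearby cylinder gives [J f >= gain * c * (t - t0)^(alpha + b)];
    the power [lambda] brings the exponent back to [b]. *)
Lemma bounded_below_step (R : realType) n (lambda alpha b N c t0 : R)
    (f : spacetime R n -> R) :
  measurable_fun setT f -> (forall z, 0 <= f z) ->
  0 <= lambda -> 0 <= alpha -> 0 < Gamma alpha -> 0 <= b ->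
  b = lambda * (alpha + b) -> (4 * pi) `^ 2^-1 <= N -> 0 <= c ->
  supersolution lambda alpha f -> bounded_below f t0 b N c ->
  bounded_below f t0 b N ((gain n alpha b * c) `^ lambda).
Proof.
move=> mf f0 l0 a0 G0 b0 bE piN c0 fsup fc.
apply: filterS fsup => -[x t] [v Jv vf] /= xN /andP[t0t tt1].
apply: le_trans vf; set s := (t - t0) / 2.
have s0 : 0 < s by rewrite divr_gt0// subr_gt0.
have s1 : s <= 1 by rewrite /s; lra.
have pi0 : 0 < 4 * pi :> R by rewrite mulr_gt0 ?pi_gt0.
have pis0 : 0 < 4 * pi * s by exact: mulr_gt0.
set l := (4 * pi * s) `^ 2^-1.
have l0' : 0 <= l by exact: powR_ge0.
have lN : l <= N.
  apply: le_trans piN; rewrite ge0_ler_powR// ?nnegrE ?(ltW pi0) ?(ltW pis0)//.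
  by rewrite -[leRHS]mulr1 ler_pM2l.
have lnE : l ^+ n = (4 * pi * s) `^ (n%:R / 2).
  by rewrite -powR_mulrn// -powRrM [2^-1 * _]mulrC.
(* The box [a i, a i + l] has [x i] as the endpoint away from the origin, which
   keeps it inside the cube. *)
pose a i := if tnth x i <= 0 then tnth x i else tnth x i - l.
(* As [t - s = t0 + s], times in [A] are at least [s] after [t0], and their lags to [t] fill
   [[s / 2, s]]. *)
pose A : set (spacetime R n) :=
  [set y : Rn R n | forall i, a i <= tnth y i <= a i + l] `*` `[t - s, t - s + s / 2].
have s20 : 0 <= s / 2 by lra.
have mA : measurable A by apply: measurableX => //; exact: measurable_box.
pose K := (s / 2) `^ alpha / s / Gamma alpha * (1 / (4 * pi * s) `^ (n%:R / 2))
    * expR (- (2 * pi * n%:R)).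
have K0 : 0 <= K.
  by rewrite !mulr_ge0 ?powR_ge0 ?expR_ge0 ?invr_ge0 ?powR_ge0 ?ltW.
have := @J_ge _ _ alpha f A (x, t) (K * (c * s `^ b)) mf f0 mA.
rewrite Jv /A lebesgue_spacetime_cylinder// -EFinM lee_fin => h.
have {h} : K * (c * s `^ b) * (l ^+ n * (s / 2)) <= v.
  apply: h.
  - by move=> [y r] [_]/=; rewrite in_itv /before/=; lra.
  - by rewrite mulr_ge0// mulr_ge0// powR_ge0.
  apply: (filterS (Filter := ae_filter_ringOfSetsType (lebesgue_spacetime n))
    _ fc) => -[y r] /= {}fc [ya]; rewrite in_itv/= => /andP[r1 r2].
  have [yN xy] : (forall i, `|tnth y i| <= N) /\ (forall i, `|tnth x i - tnth y i| <= l).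
    split=> i; have := ya i; have := xN i; rewrite /a !ler_norml; case: ifP; lra.
  apply: ler_pM => //.
  - by rewrite mulr_ge0// powR_ge0.
  - apply: Phi_near_ge => //; [lra|exact: ltW|].
    by move=> i; rewrite tnth_mktuple.
  - apply: le_trans (fc yN _); last by rewrite /s in r1 r2 *; lra.
    rewrite ler_wpM2l// ge0_ler_powR// ?nnegrE; rewrite /s in r1 r2 s0 *; lra.
(* The volume [l ^+ n] cancels the Gaussian normalisation, and the duration [s / 2] cancels the
   [1 / s] of the kernel bound. *)
have -> : K * (c * s `^ b) * (l ^+ n * (s / 2)) =
    gain n alpha b * c * (t - t0) `^ (alpha + b).
  have t00 : 0 < t - t0 by rewrite subr_gt0.
  have e1 : (s / 2) `^ alpha = 4^-1 `^ alpha * (t - t0) `^ alpha.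
    by rewrite -powRM ?ltW//; congr (_ `^ _); rewrite /s; field.
  have e2 : s `^ b = 2^-1 `^ b * (t - t0) `^ b.
    by rewrite -powRM ?ltW//; congr (_ `^ _); rewrite /s; field.
  rewrite (@powRD _ (t - t0)); last by rewrite (gt_eqF t00) implybT.
  rewrite /K lnE /gain e1 e2; clearbody s; field.
  by rewrite !gt_eqF ?powR_gt0.
have g0 : 0 <= gain n alpha b * c.
  by rewrite mulr_ge0// !mulr_ge0 ?expR_ge0 ?invr_ge0 ?powR_ge0 ?mulr_ge0 ?ltW.
move=> h; have := ge0_ler_powR l0; move=> /(_ _ _ _ _ h).
rewrite powRM ?powR_ge0// -powRrM (mulrC _ lambda) -bE; apply.
- by rewrite nnegrE mulr_ge0 ?powR_ge0.
- by rewrite nnegrE (le_trans _ h)// mulr_ge0 ?powR_ge0.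
Qed.

(** * A first lower bound *)

(** A single index controls space, time and level, so that countably many bounded sets exhaust the
    set where [f] is positive. *)
Definition superlevel_box (R : realType) n (f : spacetime R n -> R) (m : nat) :=
  [set w : spacetime R n | [/\ forall i, - m%:R <= tnth w.1 i <= m%:R,
    - m%:R <= w.2 <= m%:R & m.+1%:R^-1 <= f w]].

Lemma measurable_superlevel_box (R : realType) n (f : spacetime R n -> R) m :
  measurable_fun setT f -> measurable (superlevel_box f m).
Proof.
move=> mf; have -> : superlevel_box f m =
    ([set y : Rn R n | forall i, - m%:R <= tnth y i <= m%:R]
      `*` `[- m%:R, m%:R]) `&`
    (setT `&` (fun w : spacetime R n => m.+1%:R^-1 <= f w) @^-1` [set true]).
  rewrite setTI; apply/seteqP; split => w /=; rewrite in_itv/=; first by case.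
  by move=> [[]].
apply: measurableI; last exact: measurable_fun_ler.
by apply: measurableX => //; exact: measurable_box.
Qed.

Lemma superlevel_box_gt0 (R : realType) n (f : spacetime R n -> R) :
  measurable_fun setT f -> (forall z, 0 <= f z) ->
  ~ {ae lebesgue_spacetime n, forall z, f z = 0} ->
  exists m, (0 < lebesgue_spacetime n (superlevel_box f m))%E.
Proof.
move=> mf f0 fN0.
have mA m : measurable (superlevel_box f m) by exact: measurable_superlevel_box.
apply: contrapT => /forallNP A0; apply: fN0.
have : (lebesgue_spacetime n).-negligible (\bigcup_m superlevel_box f m).
  apply: negligible_bigcup => m; apply/negligibleP => //.
  by apply/eqP; rewrite -measure_le0 leNgt; exact/negP/A0.
apply: negligibleS => w /= /eqP fw; have {}fw : 0 < f w by rewrite lt_neqAle eq_sym fw f0.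
(* [M] dominates each coordinate, the time and [1 / f] at once; any integer above it is a valid
   index. *)
pose M := \sum_(i < n) `|tnth w.1 i| + `|w.2| + (f w)^-1.
have S0 : 0 <= \sum_(i < n) `|tnth w.1 i| by exact: sumr_ge0.
have fV0 : 0 < (f w)^-1 by rewrite invr_gt0.
have M0 : 0 <= M by rewrite !addr_ge0// ltW.
have Mm : M <= (Num.bound M)%:R by exact/ltW/archi_boundP.
exists (Num.bound M) => //; split.
- move=> i; rewrite -ler_norml; apply: le_trans Mm.
  by rewrite /M (bigD1 i)//= -!addrA lerDl !addr_ge0// ?sumr_ge0// ltW.
- rewrite -ler_norml; apply: le_trans Mm; rewrite /M; lra.
- rewrite invf_ple ?posrE//; apply: (@le_trans _ _ M).
    by rewrite /M; have := normr_ge0 w.2; lra.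
  by apply: le_trans Mm _; rewrite ler_nat.
Qed.

(** The mass of [f] on one bounded set reaches every later point through the positive kernel. The
    time [t0] is fixed before [N]; only [c] depends on [N]. *)
Lemma bounded_below_start (R : realType) n (lambda alpha b : R) (f : spacetime R n -> R) :
  measurable_fun setT f -> (forall z, 0 <= f z) ->
  0 <= lambda -> 0 <= alpha -> 0 < Gamma alpha -> 0 <= b ->
  supersolution lambda alpha f ->
  ~ {ae lebesgue_spacetime n, forall z, f z = 0} ->
  exists t0 : R, forall N, 0 <= N -> exists2 c, 0 < c & bounded_below f t0 b N c.
Proof.
move=> mf f0 l0 a0 G0 b0 fsup /(superlevel_box_gt0 mf f0)[m].
set A := superlevel_box f m => A0.
have mA : measurable A by exact: measurable_superlevel_box.
have [d d0 dA] : exists2 d : R, 0 < d & (d%:E <= lebesgue_spacetime n A)%E.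
  case: (lebesgue_spacetime n A) A0 => [r| |]//; last by exists 1; rewrite ?leey.
  by rewrite lte_fin => r0; exists r.
(* For times in [(m + 1, m + 2)] the lag from [[-m, m]] lies between 1 and [s2], and coordinates
   differ by at most [l]. *)
exists (m%:R + 1) => N N0.
pose s2 : R := m%:R + m%:R + 2; pose l := N + m%:R.
have s20 : 0 < s2 by rewrite ltr_wpDl// addr_ge0.
pose K := 1 `^ alpha / s2 / Gamma alpha * (1 / (4 * pi * s2) `^ (n%:R / 2))
    * expR (- (n%:R * l ^+ 2) / (4 * 1)).
have K0 : 0 < K.
  by rewrite /K !(mulr_gt0, invr_gt0, powR_gt0, expR_gt0)// pi_gt0.
pose k := K * m.+1%:R^-1.
have k0 : 0 < k by rewrite mulr_gt0// invr_gt0.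
exists ((k * d) `^ lambda); first by rewrite powR_gt0// mulr_gt0.
apply: filterS fsup => -[x t] [v Jv vf] /= xN /andP[t1 t2].
have := @J_ge _ _ alpha f A (x, t) k mf f0 mA.
rewrite Jv => h.
have {}h : (k%:E * lebesgue_spacetime n A <= v%:E)%E.
  apply: h.
  - by move=> [y r] [_ /= ? _]; rewrite /before/=; lra.
  - exact: ltW.
  apply: aeW => -[y r] [/= ym rm fm]; apply: ler_pM => //.
  - exact: ltW.
  - apply: Phi_ge => //; rewrite ?(ltW G0)//; [lra|rewrite /s2; lra|].
    move=> i; rewrite tnth_mktuple (le_trans (ler_normB _ _))// lerD// ler_norml.
    exact: ym.
have kdv : k * d <= v.
  by rewrite -lee_fin EFinM; apply: le_trans h; rewrite lee_pmul2l.
apply: le_trans vf; rewrite -[leRHS]mulr1; apply: ler_pM; rewrite ?powR_ge0//.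
  rewrite ge0_ler_powR// nnegrE; first by rewrite mulr_ge0// ltW.
  by apply: le_trans kdv; rewrite mulr_ge0// ltW.
apply: (@le_trans _ _ (1 `^ b)); last by rewrite powR1.
rewrite ge0_ler_powR// ?nnegrE; lra.
Qed.

(** * Contradiction with integrability *)

(** On the slab [f >= d], so the integral of [f^p] is at least [d^p (2 N)^n / 4], which is unbounded
    in [N] because [n >= 1]. *)
Lemma X_not_bounded_below (R : realType) n (p : R) (f : spacetime R n -> R)
    (t0 b N0 c : R) :
  (0 < n)%N -> 0 < p -> 0 < c -> X p f -> (forall z, 0 <= f z) -> 0 <= b ->
  ~ (forall N, N0 <= N -> bounded_below f t0 b N c).
Proof.
move=> n0 p0 c0 [mf /(_ (t0 + 1)) fX] f0 b0 fb.
set T := t0 + 1 in fX; pose g := f \_ (before T).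
pose d := c * 2^-1 `^ b.
have d0 : 0 < d by rewrite mulr_gt0// powR_gt0.
have dp0 : 0 < d `^ p by rewrite powR_gt0.
pose I := (\int[lebesgue_spacetime n]_w (`|(g w)%:E| `^ p))%E.
have Ioo : (I < +oo)%E.
  rewrite /I -(poweR_Lnorm _ (EFin \o g)) ?gt_eqF//.
  exact: poweR_lty fX.
have I0 : (0 <= I)%E by apply: integral_ge0 => w _; exact: poweR_ge0.
have [r IE] : exists r, I = r%:E by exists (fine I); rewrite fineK// ge0_fin_numE.
have r0 : 0 <= r by rewrite -lee_fin -IE.
(* With this [N], [d^p * (2 N) / 4 >= d^p / 2 + r > r]. *)
pose N := Num.max N0 (1 + 2 * (r / d `^ p)).
have N1 : 1 + 2 * (r / d `^ p) <= N by rewrite le_max lexx orbT.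
have rd0 : 0 <= r / d `^ p by rewrite divr_ge0// ltW.
pose A : set (spacetime R n) :=
  [set y : Rn R n | forall i, - N <= tnth y i <= - N + 2 * N]
  `*` `[t0 + 2^-1, t0 + 2^-1 + 4^-1].
have mA : measurable A by apply: measurableX => //; exact: measurable_box.
have mg : measurable_fun setT g.
  apply/(measurable_restrictT _ _).1 => //; first exact: measurable_before.
  exact: measurable_funTS.
have mG : measurable_fun setT (fun w => `|(g w)%:E| `^ p)%E.
  apply/measurable_EFinP.
  change (measurable_fun setT (fun w => `|g w| `^ p)).
  apply: (measurableT_comp (measurable_powR _)); exact: measurableT_comp.
have AI : ((d `^ p)%:E * lebesgue_spacetime n A <= I)%E.
  rewrite -integral_cst//; apply: (@le_trans _ _
    (\int[lebesgue_spacetime n]_(w in A) (`|(g w)%:E| `^ p))%E).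
    apply: ae_ge0_le_integral => //.
    - by move=> w _; rewrite lee_fin ltW.
    - by move=> w _; exact: poweR_ge0.
    - exact: measurable_funTS.
    have fN : bounded_below f t0 b N c by apply: fb; rewrite le_max lexx.
    apply: (filterS (Filter :=
      ae_filter_ringOfSetsType (lebesgue_spacetime n)) _ fN) => -[y t] /= ft [yN].
    rewrite /= in_itv/= => /andP[t1 t2].
    rewrite lee_fin /g /patch mem_set; last by rewrite /before /T/=; lra.
    rewrite ge0_ler_powR ?nnegrE// ?(ltW p0)// ?(ltW d0)// ger0_norm//.
    apply: (@le_trans _ _ (c * (t - t0) `^ b)).
      rewrite ler_pM2l// ge0_ler_powR// ?nnegrE; lra.
    apply: ft; last by lra.
    by move=> i; rewrite ler_norml; have := yN i; lra.
  by apply: ge0_subset_integral => // w _; exact: poweR_ge0.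
move: AI; rewrite /A lebesgue_spacetime_cylinder ?IE -?EFinM ?lee_fin//; last by lra.
have N2 : 2 * N <= (2 * N) ^+ n.
  by rewrite -[leLHS]expr1 ler_weXn2l//; lra.
move=> h; have : d `^ p * (2 * N * 4^-1) <= r.
  by apply: le_trans h; rewrite ler_pM2l// ler_pM2r.
have := N1; rewrite -(ler_pM2l dp0) mulrDr mulr1 mulrCA (mulrC _ (r / _)) divfK ?gt_eqF//.
lra.
Qed.

Lemma gain_gt0 (R : realType) (n : nat) (alpha b : R) :
  0 < Gamma alpha -> 0 < gain n alpha b.
Proof.
by move=> G0; rewrite !(mulr_gt0, expR_gt0, invr_gt0, powR_gt0).
Qed.

(** The starting constant depends on [N], but the iteration replaces it with half the fixed point,
    which does not; hence one bound on all cubes. *)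
Lemma supersolution_ae0 (R : realType) n (lambda alpha p : R)
    (f : spacetime R n -> R) :
  (0 < n)%N -> 0 < lambda < 1 -> 0 < alpha -> 0 < p -> 0 < Gamma alpha ->
  X p f -> (forall z, 0 <= f z) -> supersolution lambda alpha f ->
  {ae lebesgue_spacetime n, forall z, f z = 0}.
Proof.
move=> n0 l01 a0 p0 G0 Xf f0 fsup; apply: contrapT => fN0.
have /andP[l0 l1] := l01; have [mf _] := Xf.
pose b := lambda * alpha / (1 - lambda).
have b0 : 0 <= b by rewrite divr_ge0 ?mulr_ge0 ?subr_ge0 ?ltW.
have bE : b = lambda * (alpha + b) by rewrite /b; field; lra.
have [t0 start] :=
  bounded_below_start mf f0 (ltW l0) (ltW a0) G0 b0 fsup fN0.
have g0 := gain_gt0 n b G0.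
apply: (@X_not_bounded_below _ _ _ f t0 b ((4 * pi) `^ 2^-1)
  (gain n alpha b `^ (lambda / (1 - lambda)) / 2) n0 p0 _ Xf f0 b0).
  by rewrite divr_gt0// powR_gt0.
move=> N piN; have [c c0 fc] := start N (le_trans (powR_ge0 _ _) piN).
apply: (sublinear_iteration l01 g0 c0 fc) => [d d0 fd|d e ed fd].
  exact: bounded_below_step (ltW l0) (ltW a0) G0 b0 bE piN (ltW d0) fsup fd.
apply: (filterS (Filter := ae_filter_ringOfSetsType (lebesgue_spacetime n))
  _ fd) => z fz zN zt.
by apply: le_trans (fz zN zt); rewrite ler_wpM2r// powR_ge0.
Qed.

(** * Passage to classes modulo null sets, and the theorem *)

Lemma X_cst0 (R : realType) n (p : R) : 0 < p -> X p (cst 0 : spacetime R n -> R).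
Proof.
move=> p0; split=> // T; rewrite /finite_norm (_ : EFin \o _ = cst 0%E).
  by rewrite Lnorm0 ?eqe ?gt_eqF.
by apply/funext => w /=; rewrite /patch; case: ifP.
Qed.

Lemma X_ae_eq (R : realType) n (p : R) (f g : spacetime R n -> R) :
  measurable_fun setT g ->
  {ae lebesgue_spacetime n, forall z, f z = g z} -> X p f -> X p g.
Proof.
move=> mg fg [mf fX]; split=> // T; have := fX T; rewrite /finite_norm.
suff -> : Lnorm (lebesgue_spacetime n) p%:E (EFin \o (f \_ (before T))) =
  Lnorm (lebesgue_spacetime n) p%:E (EFin \o (g \_ (before T))) by [].
have mN (h : spacetime R n -> R) : measurable_fun setT h ->
    measurable_fun setT (fun w => `|((h \_ (before T)) w)%:E| `^ p)%E.
  move=> mh; apply/(measurable_EFinP setT (fun w => `|(h \_ (before T)) w| `^ p)).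
  apply: (measurableT_comp (measurable_powR _)).
  apply: measurableT_comp => //; apply/(measurable_restrictT _ _).1 => //.
    exact: measurable_before.
  exact: measurable_funTS.
rewrite unlock; congr (_ `^ _)%E.
apply: ae_eq_integral => //; [exact: mN|exact: mN|].
by apply: filterS fg => z fz _ /=; rewrite /patch fz.
Qed.

Theorem corollary2p1 (R : realType) (n : nat) (lambda alpha p : R)
    (n_ge1 : (1 <= n)%N)
    (lambda01 : 0 < lambda < 1)
    (alpha_p : (1 < p /\ 0 < alpha < (n%:R + 2) / (2 * p)) \/
               (p = 1 /\ 0 < alpha <= (n%:R + 2) / 2))
    (u : spacetime R n -> R) :
  [/\ Y alpha p u,
      {ae lebesgue_spacetime n, forall z, 0 <= u z},
      exists2 f, frac_heat alpha p u f &
        {ae lebesgue_spacetime n, forall z, u z `^ lambda <= f z} &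
      {ae lebesgue_spacetime n, forall z, z.2 < 0 -> u z = 0}]
  <->
  {ae lebesgue_spacetime n, forall z, u z = 0}.
Proof.
have [p0 a0] : 0 < p /\ 0 < alpha.
  by case: alpha_p => [[p1 /andP[]]|[-> /andP[]]]; split; lra.
split=> [[_ _ [f [Xf uJ] uf] _]|u0]; last first.
  have uJ : {ae lebesgue_spacetime n, forall z, (u z)%:E = J alpha (cst 0) z}.
    by apply: filterS u0 => z ->; rewrite J0.
  have X0 := X_cst0 n p0.
  split.
  - by exists (cst 0).
  - by apply: filterS u0 => z ->.
  - exists (cst 0) => //; apply: filterS u0 => z ->.
    (* A zero exponent would give the value 1 at 0; [lambda > 0] excludes it. *)
    by rewrite powR0// gt_eqF//; case/andP: lambda01.
  - by apply: filterS u0 => z ->.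
(* If the integral defining [Gamma alpha] diverged, [Gamma alpha] would be the
   junk value 0 and so would [J alpha f]; this spares a convergence proof. *)
have [G0|] := eqVneq (Gamma alpha) 0.
  apply: filterS uJ => z; rewrite /J.
  under eq_integral do rewrite /Phi G0 invr0 mulr0 !mul0r if_same mul0r.
  by rewrite integral0 => -[].
move=> GN0; have G0 : 0 < Gamma alpha by rewrite lt_neqAle eq_sym GN0 Gamma_ge0.
(* [powR] is nonnegative for every base, so [f] is nonnegative almost everywhere; [g] below is a
   representative of its class that is nonnegative everywhere. *)
have f0 : {ae lebesgue_spacetime n, forall z, 0 <= f z}.
  by apply: filterS uf => z; apply: le_trans; exact: powR_ge0.
have mf : measurable_fun setT f by case: Xf.
pose g z := Num.max (f z) 0.
have mg : measurable_fun setT g by exact: measurable_maxr.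
have fg : {ae lebesgue_spacetime n, forall z, f z = g z}.
  by apply: filterS f0 => z fz; rewrite /g max_l.
have Xg : X p g by exact: X_ae_eq fg Xf.
have JE : J alpha f = J alpha g by exact: J_ae_eq.
have g0 : {ae lebesgue_spacetime n, forall z, g z = 0}.
  apply: (supersolution_ae0 n_ge1 lambda01 a0 p0 G0 Xg).
    by move=> z; rewrite /g le_max lexx orbT.
  apply: filterS2 uJ uf => z uz fz; exists (u z); first by rewrite -JE.
  by rewrite /g le_max fz.
rewrite JE (@J_ae_eq _ _ alpha g (cst 0)) in uJ => //.
by apply: filterS uJ => z; rewrite J0 => -[].
Qed.
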